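(* Let $K$ be a compact line and $G: K \to \mathbb{R}$ a nondecreasing, positive, amenable function. Let $(f_m)_{m\in \mathbb{N}}$ be a monotone sequence of $G$-integrable functions $f_m: K \to \mathbb{R}$ that converges pointwise $G$-almost everywhere to a function $f: K \to \mathbb{R}$. If the sequence $\left(\int_K f_m \, dG\right)_{m}$ is convergent, then $f$ is also $G$-integrable on $K$ and \[\lim_{m\to \infty} \int_K f_m \, dG = \int_K f \, dG.\]
   Context: A compact line is a nonempty linearly ordered set $K$ whose order topology is compact; $0_K$ and $1_K$ denote its least and greatest elements (they exist), and intervals are written as usual, e.g. $(x,y]=\{z\in K: x<z\le y\}$. An open interval of $K$ is an interval that is an open subset of $K$. Integral. A partition of $K$ is $P=\{([x_{i-1},x_i],t_i):1\le i\le n\}$ with $0_K=x_0\le x_1\le\dots\le x_n=1_K$ in $K$ and $t_i\in[x_{i-1},x_i]$. A gauge on $K$ is a function $\delta$ assigning to each $x\in K$ an open interval $\delta(x)$ of $K$ with $x\in\delta(x)$. $P$ is $\delta$-fine, written $P\ll\delta$, if $(x_{i-1},x_i]\subset\delta(t_i)$ for all $i$. For $f,G:K\to\mathbb R$ set $S(f,G,P)=f(0_K)G(0_K)+\sum_{i=1}^n f(t_i)(G(x_i)-G(x_{i-1}))$. The function $f$ is $G$-integrable, with integral $\int_K f\,dG=A\in\mathbb R$, if for each $\varepsilon>0$ there is a gauge $\delta$ on $K$ such that $|S(f,G,P)-A|<\varepsilon$ for every $P\ll\delta$. A point $x\in[0_K,1_K)$ is right-dense if every neighborhood of $x$ contains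 a point greater than $x$; $x\in(0_K,1_K]$ is left-dense if every neighborhood of $x$ contains a point less than $x$. A function $G:K\to\mathbb R$ is amenable if it is right-continuous (at each $x\in[0_K,1_K)$, for every $\varepsilon>0$ there is a neighborhood $V$ of $x$ with $|G(y)-G(x)|<\varepsilon$ for $y\in V\cap[x,1_K]$) and regulated (the left-hand limit exists in $\mathbb R$ at every left-dense point and the right-hand limit exists in $\mathbb R$ at every right-dense point). For $G$ nondecreasing, positive and amenable there is a unique positive Radon (finite regular Borel) measure $\mu_G$ on $K$ with $\mu_G([0_K,x])=G(x)$ for all $x\in K$. For $S\subset K$ set $\mu_G^*(S)=\inf\{\sum_{n=1}^\infty\mu_G(I_n): I_n \text{ open intervals of } K,\ S\subset\bigcup_n I_n\}$. $S$ is $G$-null if $\mu_G^*(S)=0$; a property holds $G$-almost everywhere if the set of points where it fails is $G$-null. *)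

(* Defs.v *)
From HB Require Import structures.
From mathcomp Require Import all_boot all_order all_algebra.
From mathcomp Require Import all_classical all_reals all_analysis.

Set Implicit Arguments.
Unset Strict Implicit.
Unset Printing Implicit Defensive.

Import Order.TTheory GRing.Theory Num.Theory.
Import numFieldNormedType.Exports.

Local Open Scope classical_set_scope.
Local Open Scope ring_scope.

HB.mixin Record isNonemptyCompact T & Topological T := {
  line_compact : compact [set: T];
  line_nonempty : [set: T] !=set0
}.

#[short(type="compactLineType")]
HB.structure Definition CompactLine (d : Order.disp_t) :=
  {K of OrderTopological d K & isNonemptyCompact K}.

Section Endpoints.
Context {d : Order.disp_t} {K : compactLineType d}.

Lemma exists_least : exists z : K, forall x : K, (z <= x)%O.
Proof.
pose F : set_system K := filter_from setT (fun z => [set y | (y <= z)%O]).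
have FF : ProperFilter F.
  apply: filter_from_proper; last by move=> z _; exists z => /=.
  apply: filter_from_filter; first by have [p _] := @line_nonempty d K; exists p.
  move=> a b _ _; exists (Order.min a b) => // y /=.
  by rewrite le_min => /andP[].
have [p [_ clFp]] : [set: K] `&` cluster F !=set0.
  by apply: line_compact; exact: filterT.
exists p => x; rewrite leNgt; apply/negP => xp.
have /(_ _) [||y [/= yx]] := clFp [set y | (y <= x)%O] `]x, +oo[%classic.
- by exists x.
- by apply: open_nbhs_nbhs; split; [exact: rray_open|rewrite /= in_itv/= xp].
- by rewrite in_itv/= andbT ltNge yx.
Qed.

Lemma exists_greatest : exists z : K, forall x : K, (x <= z)%O.
Proof.
pose F : set_system K := filter_from setT (fun z => [set y | (z <= y)%O]).
have FF : ProperFilter F.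
  apply: filter_from_proper; last by move=> z _; exists z => /=.
  apply: filter_from_filter; first by have [p _] := @line_nonempty d K; exists p.
  move=> a b _ _; exists (Order.max a b) => // y /=.
  by rewrite ge_max => /andP[].
have [p [_ clFp]] : [set: K] `&` cluster F !=set0.
  by apply: line_compact; exact: filterT.
exists p => x; rewrite leNgt; apply/negP => px.
have /(_ _) [||y [/= xy]] := clFp [set y | (x <= y)%O] `]-oo, x[%classic.
- by exists x.
- by apply: open_nbhs_nbhs; split; [exact: lray_open|rewrite /= in_itv/= px].
- by rewrite in_itv/= ltNge xy.
Qed.

Definition line_bot : K := sval (cid exists_least).
Definition line_top : K := sval (cid exists_greatest).

Lemma line_bot_le (x : K) : (line_bot <= x)%O.
Proof. exact: (svalP (cid exists_least)). Qed.

Lemma line_top_ge (x : K) : (x <= line_top)%O.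
Proof. exact: (svalP (cid exists_greatest)). Qed.

End Endpoints.

Arguments line_bot {d} K.
Arguments line_top {d} K.

Section GaugeIntegral.
Context {d : Order.disp_t} {K : compactLineType d} {R : realType}.
Implicit Types (f G : K -> R) (A : R).

Definition open_interval (U : set K) : Prop :=
  open U /\ exists i : interval K, U = [set` i].

Definition gauge_on (delta : K -> set K) : Prop :=
  forall x, open_interval (delta x) /\ delta x x.

(* Only x_0, ..., x_n are constrained; the tag of the cell [x_i, x_{i+1}] is
   t_i (indices shifted by one). *)
Definition tagged_partition (n : nat) (x t : nat -> K) : Prop :=
  [/\ x 0%N = line_bot K, x n = line_top K &
      forall i, (i < n)%N ->
        (x i <= x i.+1)%O /\ t i \in `[x i, x i.+1]].

Definition fine_partition (delta : K -> set K) (n : nat) (x t : nat -> K) :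
    Prop :=
  forall i, (i < n)%N -> `]x i, x i.+1]%classic `<=` delta (t i).

Definition riemann_sum f G (n : nat) (x t : nat -> K) : R :=
  f (line_bot K) * G (line_bot K) +
  \sum_(0 <= i < n) f (t i) * (G (x i.+1) - G (x i)).

Definition has_gauge_integral G f A : Prop :=
  forall eps : R, 0 < eps -> exists2 delta : K -> set K, gauge_on delta &
    forall n x t, tagged_partition n x t -> fine_partition delta n x t ->
      `|riemann_sum f G n x t - A| < eps.

Definition gauge_integrable G f : Prop := exists A, has_gauge_integral G f A.

(* Equal to 0 when f is not G-integrable. *)
Definition gauge_integral G f : R := xget 0 [set A | has_gauge_integral G f A].

Definition left_dense (x : K) : Prop :=
  x <> line_bot K /\ forall V, nbhs x V -> exists2 y, V y & (y < x)%O.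

Definition right_dense (x : K) : Prop :=
  x <> line_top K /\ forall V, nbhs x V -> exists2 y, V y & (x < y)%O.

Definition right_continuous_on_line G : Prop :=
  forall x, x <> line_top K ->
    G @ within [set y | (x <= y)%O] (nbhs x) --> G x.

Definition regulated G : Prop :=
  (forall x, left_dense x ->
    cvg (G @ within [set y | (y < x)%O] (nbhs x))) /\
  (forall x, right_dense x ->
    cvg (G @ within [set y | (x < y)%O] (nbhs x))).

Definition amenable G : Prop := right_continuous_on_line G /\ regulated G.

End GaugeIntegral.

(* [g_sigma_algebraType] is measurable only over a pointed type, whereas K is
   merely nonempty. *)
Definition pointed_line {d : Order.disp_t} (K : compactLineType d) : Type := K.
HB.instance Definition _ (d : Order.disp_t) (K : compactLineType d) :=
  Choice.on (pointed_line K).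
HB.instance Definition _ (d : Order.disp_t) (K : compactLineType d) :=
  isPointed.Build (pointed_line K) (line_bot K).

Notation borel K := (@g_sigma_algebraType (pointed_line K) (@open K)).

Section RadonMeasure.
Context {d : Order.disp_t} {K : compactLineType d} {R : realType}.
Local Open Scope ereal_scope.

Definition regular_measure (mu : {finite_measure set (borel K) -> \bar R}) :
    Prop :=
  forall B : set (borel K), measurable B ->
    mu B = ereal_inf [set mu U | U in [set U : set K | open U /\ B `<=` U]] /\
    mu B = ereal_sup [set mu C | C in [set C : set K | compact C /\ C `<=` B]].

(* These two properties characterize the measure \mu_G. *)
Definition is_distribution_measure (G : K -> R)
    (mu : {finite_measure set (borel K) -> \bar R}) : Prop :=
  regular_measure mu /\
  forall x : K, mu `[line_bot K, x]%classic = (G x)%:E.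

Definition outer_mu (mu : {finite_measure set (borel K) -> \bar R})
    (S : set K) : \bar R :=
  ereal_inf [set \sum_(0 <= n <oo) mu (I n) | I in
    [set I : nat -> set K |
      (forall n, open_interval (I n)) /\ S `<=` \bigcup_n I n]].

Definition null_set (mu : {finite_measure set (borel K) -> \bar R})
    (S : set K) : Prop := outer_mu mu S = 0.

Definition almost_everywhere_wrt
    (mu : {finite_measure set (borel K) -> \bar R}) (P : K -> Prop) : Prop :=
  null_set mu [set x | ~ P x].

End RadonMeasure.

(* Main.v *)
(* By Cousin's lemma every gauge on a compact line has fine partitions.  If
   [f_ m] increases to [f] everywhere, let each point [t] use the gauge of an
   index [m t] at which [f_ (m t) t] is already close to [f t], and replace the
   cells of a fine partition by pieces fine for all the gauges involved: the
   sum of the [f_ (m t) t] changes little (Henstock's argument), and becomes a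
   sum lying between those of two functions [f_ N] and [f_ M].  A function
   vanishing off a null set has integral 0, because its tags at each level of
   size are confined to a small open set; this removes the exceptional set. *)
Require Import Defs.
From HB Require Import structures.
From mathcomp Require Import all_boot all_order all_algebra.
From mathcomp Require Import all_classical all_reals all_analysis.
From mathcomp Require Import ring lra.

Set Implicit Arguments.
Unset Strict Implicit.
Unset Printing Implicit Defensive.

Import Order.TTheory GRing.Theory Num.Theory.
Import numFieldNormedType.Exports.

Local Open Scope classical_set_scope.
Local Open Scope ring_scope.

(** * Chains of tagged cells and their sums *)

Section Chains.
Context {d : Order.disp_t} {K : compactLineType d} {R : realType}.
Implicit Types (delta : K -> set K) (f g G : K -> R) (a b c t y : K).
Implicit Types s : seq (K * K).

(* A chain from [a] to [b] lists the cells of a tagged partition of [a, b] as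
   pairs (tag, right endpoint). *)
Fixpoint fine_chain delta a s b : Prop :=
  if s is (t, y) :: s' then
    [/\ t \in `[a, y], `]a, y]%classic `<=` delta t & fine_chain delta y s' b]
  else a = b.

Fixpoint chain_sum G f a s : R :=
  if s is (t, y) :: s' then f t * (G y - G a) + chain_sum G f y s' else 0.

Lemma fine_chain_cat delta a s b s' c :
  fine_chain delta a s b -> fine_chain delta b s' c ->
  fine_chain delta a (s ++ s') c.
Proof.
elim: s a => [a ->//|[t y] s IH a [ty sd /IH h] /h h']; by split.
Qed.

Lemma fine_chain_sub delta delta' a s b :
  (forall t, delta t `<=` delta' t) ->
  fine_chain delta a s b -> fine_chain delta' a s b.
Proof.
move=> sub; elim: s a => [//|[t y] s IH a [ty sd /IH h]]; split=> //.
exact: subset_trans (sub t).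
Qed.

Lemma chain_sum_cat G f delta a s b s' : fine_chain delta a s b ->
  chain_sum G f a (s ++ s') = chain_sum G f a s + chain_sum G f b s'.
Proof.
elim: s a => [a ->/=|[t y] s IH a [ty sd /IH h]] /=; first by rewrite add0r.
by rewrite h addrA.
Qed.

Lemma chain_sumD G f g a s :
  chain_sum G (f \+ g) a s = chain_sum G f a s + chain_sum G g a s.
Proof.
elim: s a => [a|[t y] s IH a] /=; first by rewrite addr0.
by rewrite IH /=; ring.
Qed.

Lemma chain_sumN G f a s :
  chain_sum G (fun x => - f x) a s = - chain_sum G f a s.
Proof.
elim: s a => [a|[t y] s IH a] /=; first by rewrite oppr0.
by rewrite IH /=; ring.
Qed.

Lemma chain_sumB G f g a s :
  chain_sum G (fun x => f x - g x) a s = chain_sum G f a s - chain_sum G g a s.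
Proof. by rewrite (chain_sumD G f (fun x => - g x)) chain_sumN. Qed.

Lemma chain_sum_cst G r delta a s b : fine_chain delta a s b ->
  chain_sum G (fun=> r) a s = r * (G b - G a).
Proof.
elim: s a => [a <-/=|[t y] s IH a [ty sd /IH h]] /=; first by rewrite subrr mulr0.
by rewrite h; ring.
Qed.

Lemma ler_chain_sum G f g delta a s b :
  (forall x y : K, (x <= y)%O -> G x <= G y) ->
  fine_chain delta a s b -> (forall z, z \in s -> f z.1 <= g z.1) ->
  chain_sum G f a s <= chain_sum G g a s.
Proof.
move=> Gnd; elim: s a => [//|[t y] s IH a [+ sd h] fg] /=.
rewrite in_itv/= => /andP[at_ ty]; apply: lerD; last first.
  by apply: IH => // z zs; apply: fg; rewrite in_cons zs orbT.
apply: ler_wpM2r; first by rewrite subr_ge0 Gnd// (le_trans at_).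
exact: (fg (t, y) (mem_head _ _)).
Qed.

Lemma ler_norm_chain_sum G f delta a s b :
  (forall x y : K, (x <= y)%O -> G x <= G y) ->
  fine_chain delta a s b ->
  `|chain_sum G f a s| <= chain_sum G (fun x => `|f x|) a s.
Proof.
move=> Gnd + ; elim: s a => [|[t y] s IH a [+ sd /IH h]] /=; first by rewrite normr0.
rewrite in_itv/= => /andP[at_ ty].
apply: (le_trans (ler_normD _ _)); apply: lerD => //.
by rewrite normrM (ger0_norm (x := G y - _))// subr_ge0 Gnd// (le_trans at_).
Qed.

(** * Suprema in a compact line and Cousin's lemma *)

Lemma mem_itv_convex (i : interval K) a b y :
  a \in i -> b \in i -> (a <= y <= b)%O -> y \in i.
Proof.
case: i => l u; rewrite !itv_boundlr => /andP[la _] /andP[_ bu] /andP[ay yb].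
by rewrite (le_trans la)//= (le_trans _ bu).
Qed.

(** The supremum is a cluster point of the upper tails of [C]: a point of [C] above it, or an upper
    bound below it, would give it an open ray missing some tail. The third clause is what lets
    [cousin] reach the supremum. *)
Lemma line_sup (C : set K) : C !=set0 -> exists p,
  [/\ forall c, C c -> (c <= p)%O, forall u, ubound C u -> (p <= u)%O &
      forall U, nbhs p U -> exists2 c, C c & U c].
Proof.
move=> [c0 Cc0].
pose F : set_system K := filter_from C (fun z => [set y | C y /\ (z <= y)%O]).
have FF : ProperFilter F.
  apply: filter_from_proper; last by move=> z Cz; exists z => /=.
  apply: filter_from_filter; first by exists c0.
  move=> a b Ca Cb; exists (Order.max a b).
    by rewrite /Order.max; case: ifP.
  by move=> y /= [Cy]; rewrite ge_max => /andP[].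
have [p [_ clFp]] : [set: K] `&` cluster F !=set0.
  by apply: line_compact; exact: filterT.
exists p; split.
- move=> c Cc; rewrite leNgt; apply/negP => pc.
  have /(_ _) [||y [/= [_ yc]]] := clFp [set y | C y /\ (c <= y)%O] `]-oo, c[%classic.
  + by exists c.
  + by apply: open_nbhs_nbhs; split; [exact: lray_open|rewrite /= in_itv].
  + by rewrite in_itv/= ltNge yc.
- move=> u uC; rewrite leNgt; apply/negP => up.
  have /(_ _) [||y [/= [Cy _]]] := clFp [set y | C y /\ (c0 <= y)%O] `]u, +oo[%classic.
  + by exists c0.
  + by apply: open_nbhs_nbhs; split; [exact: rray_open|rewrite /= in_itv/= up].
  + by rewrite in_itv/= andbT ltNge uC.
- move=> U pU; have [|y [[Cy _] Uy]] := clFp [set y | C y /\ (c0 <= y)%O] U _ pU.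
    by exists c0.
  by exists y.
Qed.

(** The points up to [b] reached from [a] have a supremum [p]; it is itself reached, and [p < b]
    would permit a further step. Only neighbourhoods are asked for, so that [delta] may be a finite
    intersection of gauges. *)
Lemma cousin delta a b : (forall x, nbhs x (delta x)) -> (a <= b)%O ->
  exists s, fine_chain delta a s b.
Proof.
move=> dn ab.
pose C := [set y | (y <= b)%O /\ exists s, fine_chain delta a s y].
have [|p [Cp pC nbp]] := @line_sup C; first by exists a; split=> //; exists [::].
have pb : (p <= b)%O by apply: pC => y [].
move: (dn p); rewrite itv_nbhsE => -[i [oi pi] id].
(* Some [c] in [C] lies in [i], and the cell []c, p]] with tag [p] completes its chain. *)
have [s sp] : exists s, fine_chain delta a s p.
  have [|c Cc ci] := nbp [set` i].
    by rewrite itv_nbhsE; exists i.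
  have cp := Cp _ Cc; have [_ [s sc]] := Cc; exists (s ++ [:: (p, p)]).
  apply: (fine_chain_cat sc); split=> //; first by rewrite in_itv/= cp lexx.
  move=> z /=; rewrite in_itv/= => /andP[cz zp]; apply: id.
  by apply: (mem_itv_convex ci pi); rewrite (ltW cz).
have [<-|nepb] := eqVneq p b; first by exists s.
have {nepb}ltpb : (p < b)%O by rewrite lt_neqAle nepb.
(* The point [y0] itself may fall outside [i], as its excluded right end. *)
have [y0 [py0 y0b iy0]] : exists y0, [/\ (p < y0)%O, (y0 <= b)%O &
    forall z, (p < z < y0)%O -> z \in i].
  case: i oi pi id => l [[] r|[]] oi pi _.
  - move: pi; rewrite itv_boundlr/= => /andP[lp pr].
    exists (Order.min r b); split.
    + by rewrite lt_min ltpb andbT; move: pr; rewrite bnd_simp.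
    + by rewrite ge_min lexx orbT.
    + move=> z; rewrite lt_min => /and3P[pz zr zb].
      by rewrite itv_boundlr (le_trans lp)/= bnd_simp// ltW.
  - by move: oi => /itv_open_ends_rside.
  - by move: oi => /itv_open_ends_rinfty.
  - move: pi; rewrite itv_boundlr/= => /andP[lp _]; exists b; split=> // z /andP[pz _].
    by rewrite itv_boundlr (le_trans lp)//= bnd_simp ltW.
(* A point strictly between [p] and [y0] is reached with tag [p]. If there is none, [y0] is the
   successor of [p], so []p, y0]] is the singleton of [y0] and the tag [y0] serves. Either way [C]
   exceeds its supremum. *)
have [[z /andP[pz zy0]]|nz] := pselect (exists z, (p < z < y0)%O).
  have : C z.
    split; first exact: (le_trans (ltW zy0)).
    exists (s ++ [:: (p, z)]); apply: (fine_chain_cat sp); split=> //.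
      by rewrite in_itv/= lexx ltW.
    move=> w /=; rewrite in_itv/= => /andP[pw wz]; apply/id/iy0.
    by rewrite pw (le_lt_trans wz).
  by move/Cp; rewrite leNgt pz.
have : C y0.
  split=> //; exists (s ++ [:: (y0, y0)]).
  apply: (fine_chain_cat sp); split=> //; first by rewrite in_itv/= lexx ltW.
  move=> w /=; rewrite in_itv/= => /andP[pw]; rewrite le_eqVlt => /orP[/eqP->|wy0].
    exact: nbhs_singleton.
  by exfalso; apply: nz; exists w; rewrite pw.
by move/Cp; rewrite leNgt py0.
Qed.

(** * Partitions as chains, and elementary properties of the integral *)

Lemma gauge_on_nbhs delta : gauge_on delta -> forall x, nbhs x (delta x).
Proof. by move=> gd x; have [[opn _] dx] := gd x; exact: open_nbhs_nbhs. Qed.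

Lemma fine_chain_of_partition delta n (x t : nat -> K) :
  (forall i, (i < n)%N -> (x i <= x i.+1)%O /\ t i \in `[x i, x i.+1]) ->
  fine_partition delta n x t ->
  exists2 s, fine_chain delta (x 0%N) s (x n) &
    forall G f, \sum_(0 <= i < n) f (t i) * (G (x i.+1) - G (x i)) =
      chain_sum G f (x 0%N) s.
Proof.
elim: n x t => [x t _ _|n IH x t xt fp].
  by exists [::] => // G f; rewrite big_geq.
have [||s sc sE] := IH (x \o S) (t \o S).
- by move=> i ni; exact: (xt i.+1).
- by move=> i ni; exact: (fp i.+1).
exists ((t 0%N, x 1%N) :: s).
  by split=> //; [have [] := xt 0%N isT|exact: (fp 0%N isT)].
by move=> G f; rewrite big_nat_recl// sE.
Qed.

Lemma partition_of_fine_chain delta a s b : fine_chain delta a s b ->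
  exists n (x t : nat -> K), [/\ x 0%N = a, x n = b,
    forall i, (i < n)%N -> (x i <= x i.+1)%O /\ t i \in `[x i, x i.+1],
    fine_partition delta n x t &
    forall G f, \sum_(0 <= i < n) f (t i) * (G (x i.+1) - G (x i)) =
      chain_sum G f a s].
Proof.
elim: s a => [a <-|[t y] s IH a [ty sd /IH]] /=.
  exists 0%N, (fun=> a), (fun=> a); split=> // G f; by rewrite big_geq.
move=> [n [x' [t' [x0 xn xt fp sE]]]].
exists n.+1, (fun i => if i is j.+1 then x' j else a),
  (fun i => if i is j.+1 then t' j else t); split=> //.
- case=> [_|i /xt//]; rewrite x0; split=> //.
  by move: ty; rewrite in_itv/= => /andP[]; exact: le_trans.
- by case=> [_|i /fp//]; rewrite x0.
- by move=> G f; rewrite big_nat_recl//= sE x0.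
Qed.

(** Lets the later arguments work by induction on lists and by concatenation instead of with indexed
    families. *)
Lemma has_gauge_integralP G f (A : R) : has_gauge_integral G f A <->
  forall eps : R, 0 < eps -> exists2 delta, gauge_on delta &
    forall s, fine_chain delta (line_bot K) s (line_top K) ->
      `|f (line_bot K) * G (line_bot K) + chain_sum G f (line_bot K) s - A|
        < eps.
Proof.
split=> H eps /H[delta gd D]; exists delta => //.
  move=> s /partition_of_fine_chain[n [x [t [x0 xn xt fp sE]]]].
  by rewrite -sE; apply: D.
move=> n x t [x0 xn xt] /(fine_chain_of_partition xt)[s sc sE].
by rewrite /riemann_sum sE x0; apply: D; rewrite -x0 -xn.
Qed.

Lemma open_intervalI (U V : set K) :
  open_interval U -> open_interval V -> open_interval (U `&` V).
Proof.
move=> [oU [i Ui]] [oV [j Vj]]; split; first exact: openI.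
by exists (i `&` j)%O; rewrite set_itvI Ui Vj.
Qed.

Lemma gauge_onI delta delta' : gauge_on delta -> gauge_on delta' ->
  gauge_on (fun x => delta x `&` delta' x).
Proof.
move=> gd gd' x; have [[iU Ux] [iV Vx]] := (gd x, gd' x).
by split; [exact: open_intervalI|].
Qed.

(** By Cousin's lemma some chain is fine for both gauges, so one sum is close to both values. *)
Lemma has_gauge_integral_unique G f (A B : R) :
  has_gauge_integral G f A -> has_gauge_integral G f B -> A = B.
Proof.
move=> /has_gauge_integralP fA /has_gauge_integralP fB.
apply/eqP; rewrite -subr_eq0 -normr_eq0 eq_le normr_ge0 andbT.
apply/ler_addgt0Pr => e e0; rewrite add0r; have e20 : 0 < e / 2 by rewrite divr_gt0.
have [[dA gA HA] [dB gB HB]] := (fA _ e20, fB _ e20).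
have [s sc] := cousin (gauge_on_nbhs (gauge_onI gA gB)) (line_bot_le (line_top K)).
have /HA := fine_chain_sub (fun t => @subIsetl _ (dA t) (dB t)) sc.
have /HB := fine_chain_sub (fun t => @subIsetr _ (dA t) (dB t)) sc.
rewrite !ltr_norml !ler_norml => /andP[? ?] /andP[? ?].
by apply/andP; split; lra.
Qed.

Lemma gauge_integralE G f (A : R) :
  has_gauge_integral G f A -> gauge_integral G f = A.
Proof.
move=> fA; apply: xget_unique => // B fB.
exact: has_gauge_integral_unique fB fA.
Qed.

Lemma has_gauge_integralD G f g (A B : R) :
  has_gauge_integral G f A -> has_gauge_integral G g B ->
  has_gauge_integral G (f \+ g) (A + B).
Proof.
move=> /has_gauge_integralP fA /has_gauge_integralP gB.
apply/has_gauge_integralP => e e0; have e20 : 0 < e / 2 by rewrite divr_gt0.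
have [[dA gA HA] [dB gB' HB]] := (fA _ e20, gB _ e20).
exists (fun x => dA x `&` dB x); first exact: gauge_onI.
move=> s sc.
have /HA := fine_chain_sub (fun t => @subIsetl _ (dA t) (dB t)) sc.
have /HB := fine_chain_sub (fun t => @subIsetr _ (dA t) (dB t)) sc.
rewrite chain_sumD /= mulrDl !ltr_norml => /andP[? ?] /andP[? ?].
by apply/andP; split; lra.
Qed.

Lemma has_gauge_integralN G f (A : R) :
  has_gauge_integral G f A -> has_gauge_integral G (fun x => - f x) (- A).
Proof.
move=> /has_gauge_integralP fA; apply/has_gauge_integralP => e /fA[dA gA HA].
by exists dA => // s /HA; rewrite chain_sumN mulNr -!opprD normrN.
Qed.

(** * Henstock's argument and convergence everywhere *)

(* The Henstock argument without integrals over subintervals: the sum over [s]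
   of [f_ (m t)] splits, up to the differences [D k] of two sums of [f_ k] over
   [delta k]-fine chains, into a sum [L] over a common refinement [q] which is
   fine for all the relevant gauges. *)
Lemma chain_refinement G (f_ : nat -> K -> R) (delta : nat -> K -> set K)
    (m : K -> nat) N M a s b :
  (forall x y : K, (x <= y)%O -> G x <= G y) ->
  (forall x, nondecreasing_seq (f_ ^~ x)) ->
  (forall k, gauge_on (delta k)) ->
  fine_chain (fun t => delta (m t) t) a s b ->
  (forall z, z \in s -> (N <= m z.1 < M)%N) ->
  exists q (D : nat -> R) (L : R),
  [/\ forall k, (k <= M)%N -> fine_chain (delta k) a q b,
      forall k, (k < M)%N -> exists2 qk, fine_chain (delta k) a qk b &
        D k = chain_sum G (f_ k) a qk - chain_sum G (f_ k) a q,
      chain_sum G (f_ N) a q <= L <= chain_sum G (f_ M) a q &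
      chain_sum G (fun t => f_ (m t) t) a s = \sum_(k < M) D k + L].
Proof.
move=> Gnd fnd gd; elim: s a => [a <- _|[t y] s IH a [ty sd /IH{}IH] sm].
  exists [::], (fun=> 0), 0; split=> //=.
  - by move=> k _; exists [::] => //=; rewrite subrr.
  - by rewrite lexx.
  - by rewrite big1// addr0.
have [|q' [D' [L' [q'c D'E /andP[NL LM] sE]]]] := IH.
  by move=> z zs; apply: sm; rewrite in_cons zs orbT.
have /andP[Nmt mtM] : (N <= m t < M)%N by have := sm (t, y) (mem_head _ _).
have ay : (a <= y)%O.
  by move: ty; rewrite in_itv/= => /andP[]; exact: le_trans.
(* The cell []a, y]] is refined for all indices up to [M] at once: finitely many gauges still
   intersect in a neighbourhood. *)
have [|q0 q0c] := @cousin (fun t => [set z | forall k, (k <= M)%N -> delta k t z]) _ _ _ ay.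
  move=> x; have : \forall z \near x, forall k : 'I_M.+1, delta k x z.
    by apply: filter_forall => k; exact: gauge_on_nbhs.
  apply: filterS => z H k; rewrite -ltnS => kM.
  exact: (H (Ordinal kM)).
have q0k k : (k <= M)%N -> fine_chain (delta k) a q0 y.
  by move=> kM; apply: fine_chain_sub q0c => x z; exact.
(* Trading the cell tagged [t] for [q0] costs an error in [f_ (m t)] alone, so only [D (m t)]
   changes. *)
exists (q0 ++ q'), (fun k => D' k + if k == m t then
    f_ k t * (G y - G a) - chain_sum G (f_ k) a q0 else 0),
  (L' + chain_sum G (f_ (m t)) a q0).
have sumE k : chain_sum G (f_ k) a (q0 ++ q') =
    chain_sum G (f_ k) a q0 + chain_sum G (f_ k) y q'.
  exact: chain_sum_cat q0c.
split.
- by move=> k kM; apply: fine_chain_cat (q'c k kM); exact: q0k.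
(* For [k = m t] the original cell is kept, being [delta k]-fine; for any other [k] the chain [qk]
   takes [q0], whose contribution cancels. *)
- move=> k kM; have [qk qkc DkE] := D'E k kM; have [kmt|kmt] := eqVneq k (m t).
    exists ((t, y) :: qk); first by split=> //; rewrite kmt.
    by rewrite DkE sumE/=; ring.
  exists (q0 ++ qk); first exact: fine_chain_cat (q0k _ (ltnW kM)) qkc.
  by rewrite DkE sumE (chain_sum_cat _ _ _ q0c); ring.
- rewrite !sumE ![chain_sum _ _ a q0 + _]addrC; apply/andP; split; apply: lerD => //.
  + by apply: ler_chain_sum q0c _ => // x _; exact: fnd.
  + by apply: ler_chain_sum q0c _ => // x _; apply: fnd; exact: ltnW.
- rewrite /= sE big_split/= -big_mkcond/=.
  rewrite (big_pred1 (Ordinal mtM) (P := fun k : 'I_M => k == m t :> nat))/=.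
    by ring.
  by move=> k; rewrite /= -val_eqE.
Qed.

Lemma sum_half_geometric n : \sum_(k < n) (2 ^- k.+1 : R) <= 1.
Proof.
have -> : \sum_(k < n) (2 ^- k.+1 : R) = 1 - 2 ^- n.
  elim: n => [|n IH]; first by rewrite big_ord0 expr0 invr1 subrr.
  by rewrite big_ord_recr/= IH exprS invfM; field.
by rewrite gerBl invr_ge0 exprn_ge0.
Qed.

Lemma gauge_monotone_convergence G (f_ : nat -> K -> R) f (A_ : nat -> R) (A : R) :
  (forall x y : K, (x <= y)%O -> G x <= G y) -> (forall x, 0 <= G x) ->
  (forall x, nondecreasing_seq (f_ ^~ x)) ->
  (forall k, has_gauge_integral G (f_ k) (A_ k)) ->
  (forall x, f_ k x @[k --> \oo] --> f x) -> A_ k @[k --> \oo] --> A ->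
  has_gauge_integral G f A.
Proof.
move=> Gnd Gge0 fnd fint fcvg Acvg; apply/has_gauge_integralP => eps eps0.
(* The errors are [e * G1] for the term at [line_bot K], [e * G1] for replacing [f] by [f_ (m t)],
   [2 * e] for the [D k], [e] for a sum of [f_ N] or [f_ M] against its integral, and [e] for that
   integral against [A]. The 6 leaves slack and keeps the divisor positive when [G1 = 0]. *)
pose G1 := G (line_top K); pose e := eps / (2 * G1 + 6).
have G10 : 0 <= G1 := Gge0 _.
have e0 : 0 < e by rewrite divr_gt0//; lra.
have [N _ HN] : \forall k \near \oo, `|A - A_ k| <= e /\
    `|f (line_bot K) - f_ k (line_bot K)| <= e.
  have /cvgrPdist_le/(_ _ e0) HA := Acvg.
  have /cvgrPdist_le/(_ _ e0) Hf := fcvg (line_bot K).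
  exact: filterI HA Hf.
(* With [N <= m t], the refined sum lies above one of [f_ N], whose integral is already near [A]. *)
have /choice[m Hm] : forall t, exists k, (N <= k)%N /\ `|f t - f_ k t| <= e.
  move=> t; have /cvgrPdist_le/(_ _ e0)[k _ Hk] := fcvg t.
  by exists (maxn N k); rewrite leq_maxl; split=> //; apply: Hk; rewrite /= leq_maxr.
(* Tolerances halve with [k], so the [D k] add up to at most [2 * e] however many indices the tags
   use. *)
have /choice[delta Hd] : forall k, exists delta, gauge_on delta /\
    forall s, fine_chain delta (line_bot K) s (line_top K) ->
      `|f_ k (line_bot K) * G (line_bot K) +
        chain_sum G (f_ k) (line_bot K) s - A_ k| < e * 2 ^- k.+1.
  move=> k; have /has_gauge_integralP/(_ (e * 2 ^- k.+1)) [|dl gd Hd] := fint k.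
    by rewrite mulr_gt0// invr_gt0 exprn_gt0.
  by exists dl.
have gd k := (Hd k).1; have {}Hd k := (Hd k).2.
exists (fun t => delta (m t) t); first by move=> x; exact: gd.
move=> s sc.
have [M NM HM] : exists2 M, (N <= M)%N & forall z, z \in s -> (N <= m z.1 < M)%N.
  exists (maxn N (\max_(z <- s) m z.1).+1) => [|z zs]; first exact: leq_maxl.
  by rewrite (Hm z.1).1/= leq_max ltnS; apply/orP; right; exact: leq_bigmax_seq.
have [q [D [L [qc DE /andP[NL LM] sE]]]] := chain_refinement Gnd fnd gd sc HM.
have sumD : `|\sum_(k < M) D k| <= 2 * e.
  apply: (le_trans (ler_norm_sum _ _ _)).
  apply: (@le_trans _ _ (\sum_(k < M) 2 * e * 2 ^- k.+1)).
    apply: ler_sum => k _; have [qk qkc ->] := DE _ (ltn_ord k).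
    have /Hd := qkc; have /Hd := qc _ (ltnW (ltn_ord k)).
    rewrite -mulrA !ltr_norml !ler_norml => /andP[? ?] /andP[? ?].
    by apply/andP; split; lra.
  by rewrite -mulr_sumr ler_piMr ?sum_half_geometric// mulr_ge0// ltW.
have half_le1 k : e * 2 ^- k.+1 <= e.
  apply: ler_piMr; first exact: ltW.
  by rewrite invf_le1 ?exprn_gt0// exprn_ege1// ler1n.
have sumfm : `|chain_sum G f (line_bot K) s -
    chain_sum G (fun t => f_ (m t) t) (line_bot K) s| <= e * G1.
  rewrite -chain_sumB; apply: (le_trans (ler_norm_chain_sum _ Gnd sc)).
  apply: (@le_trans _ _ (chain_sum G (fun=> e) (line_bot K) s)).
    by apply: ler_chain_sum sc _ => // t _; exact: (Hm t.1).2.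
  by rewrite (chain_sum_cst _ _ sc) ler_wpM2l ?(ltW e0)// gerBl.
have [AN fN] := HN N (leqnn N).
have [AM fM] := HN M NM.
have qN := lt_le_trans (Hd _ _ (qc N NM)) (half_le1 N).
have qM := lt_le_trans (Hd _ _ (qc M (leqnn M))) (half_le1 M).
have eE : eps = 2 * (e * G1) + 6 * e by rewrite /e; field; lra.
have G0 : G (line_bot K) <= G1 := Gnd _ _ (line_top_ge _).
have bnd_prod k : `|f (line_bot K) - f_ k (line_bot K)| <= e ->
    `|f (line_bot K) * G (line_bot K) - f_ k (line_bot K) * G (line_bot K)|
      <= e * G1.
  by move=> fk; rewrite -mulrBl normrM (ger0_norm (Gge0 _)); apply: ler_pM.
move: sumD sumfm qN qM AN AM (bnd_prod _ fN) (bnd_prod _ fM); rewrite sE eE.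
rewrite !ler_norml !ltr_norml.
do 8 ! move=> /andP[? ?].
by apply/andP; split; lra.
Qed.


Lemma chain_sum_linear G n (c : 'I_n -> R) (g : 'I_n -> K -> R) a s :
  chain_sum G (fun t => \sum_(k < n) c k * g k t) a s =
  \sum_(k < n) c k * chain_sum G (g k) a s.
Proof.
elim: s a => [a|[t y] s IH a] /=; first by rewrite big1// => k _; rewrite mulr0.
by rewrite IH mulr_suml -big_split/=; apply: eq_bigr => k _; ring.
Qed.

End Chains.

(** * The measure of cells, and null sets *)

Section NullSets.
Context {d : Order.disp_t} {K : compactLineType d} {R : realType}.
Context (G : K -> R) (mu : {finite_measure set (borel K) -> \bar R}).
Context (Gnd : forall x y : K, (x <= y)%O -> G x <= G y).
Context (muE : forall x : K, mu `[line_bot K, x]%classic = (G x)%:E).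

Lemma measurable_open_line (U : set K) :
  open U -> measurable (U : set (borel K)).
Proof. by move=> oU; exact: sub_sigma_algebra. Qed.

Lemma measurable_line_oc (a b : K) :
  measurable (`]a, b]%classic : set (borel K)).
Proof.
have -> : (`]a, b]%classic : set K) = `]a, +oo[%classic `\` `]b, +oo[%classic.
  apply/seteqP; split=> z /=; rewrite !in_itv/= !andbT.
    by move=> /andP[az zb]; split=> //; apply/negP; rewrite -leNgt.
  by move=> [-> /negP]; rewrite -leNgt.
by apply: measurableD; apply: (measurable_open_line (rray_open _)).
Qed.

Lemma measurable_line_bot (b : K) :
  measurable (`[line_bot K, b]%classic : set (borel K)).
Proof.
have -> : (`[line_bot K, b]%classic : set K) = ~` `]b, +oo[%classic.
  apply/seteqP; split=> z /=; rewrite !in_itv/= !andbT line_bot_le/=.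
    by move=> zb; apply/negP; rewrite -leNgt.
  by move=> /negP; rewrite -leNgt.
by apply: measurableC; apply: (measurable_open_line (rray_open _)).
Qed.

Lemma measure_line_oc (a b : K) : (a <= b)%O ->
  mu `]a, b]%classic = (G b - G a)%:E.
Proof.
move=> ab; have fin : mu `]a, b]%classic \is a fin_num.
  by apply: fin_num_measure; exact: measurable_line_oc.
have : mu (`[line_bot K, a] `|` `]a, b])%classic = (G a)%:E + mu `]a, b]%classic.
  rewrite -muE; apply: measureU;
    [exact: measurable_line_bot|exact: measurable_line_oc|].
  apply/seteqP; split=> // z [] /=; rewrite !in_itv/= line_bot_le/=.
  by move=> za /andP[]; rewrite ltNge za.
have -> : (`[line_bot K, a] `|` `]a, b])%classic = (`[line_bot K, b] : set K)%classic.
  apply/seteqP; split=> z /=; rewrite !in_itv/= line_bot_le/=.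
    by move=> [za|/andP[]//]; exact: le_trans ab.
  by move=> zb; case: (leP z a) => za; [left|right].
rewrite [X in X = _]muE -(fineK fin) -EFinD => -[->].
by rewrite addrC addKr.
Qed.

(** The cells tagged in [A] are disjoint subsets of [U], and each increment of [G] is the measure of
    its cell. Only cells are measured, so [A] may be arbitrary. *)
Lemma tag_sum_le_measure (A U : set K) delta a s b :
  open U -> (forall t, A t -> delta t `<=` U) -> fine_chain delta a s b ->
  ((chain_sum G \1_A a s)%:E <= mu U)%E.
Proof.
move=> oU AU sc.
(* Here [W] is the union of these cells; its lying in []a, +oo[] keeps it disjoint from a cell added
   in front. *)
suff [W [mW WU _ <-]] : exists W : set (borel K),
    [/\ measurable W, W `<=` U, W `<=` `]a, +oo[%classic &
        mu W = (chain_sum G \1_A a s)%:E].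
  by apply: le_measure => //; rewrite inE//; exact: measurable_open_line.
elim: s a sc => [a _|[t y] s IH a [+ sd /IH[W [mW WU Wy Wm]]]].
  by exists set0; split=> //; rewrite measure0.
rewrite in_itv/= => /andP[at_ ty]; have ay := le_trans at_ ty.
have [At|nAt] := pselect (A t); last first.
  exists W; split=> //.
    by move=> z /Wy /=; rewrite !in_itv/= !andbT; exact: le_lt_trans.
  by rewrite Wm indicE memNset// mul0r add0r.
exists (`]a, y]%classic `|` W); split.
- by apply: measurableU => //; exact: measurable_line_oc.
- by rewrite subUset; split=> //; apply: (subset_trans sd); exact: AU.
- rewrite subUset; split=> z; last move=> /Wy.
    by rewrite /= !in_itv/= andbT => /andP[].
  by rewrite /= !in_itv/= !andbT; exact: le_lt_trans.
- have -> : mu (`]a, y]%classic `|` W) = (mu `]a, y]%classic + mu W)%E.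
    apply: measureU => //; first exact: measurable_line_oc.
    apply/seteqP; split=> // z [] /=; rewrite in_itv/= => /andP[_ zy] /Wy /=.
    by rewrite in_itv/= andbT ltNge zy.
  by rewrite Wm measure_line_oc// indicE mem_set// mul1r EFinD.
Qed.

(* Unqualified, [null_set] would be MathComp-Analysis's notion. *)
Lemma null_set_cover (S : set K) (c : R) : Defs.null_set mu S -> 0 < c ->
  exists I : nat -> set K, [/\ forall n, open_interval (I n),
    S `<=` \bigcup_n I n & (mu (\bigcup_n I n) < c%:E)%E].
Proof.
move=> S0 c0.
have : (outer_mu mu S < c%:E)%E by rewrite S0 lte_fin.
move=> /ereal_inf_lt[_ [I [oI SI] <-] Ic].
exists I; split=> //; apply: le_lt_trans Ic.
have mI n : measurable (I n : set (borel K)).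
  by apply: measurable_open_line; have [] := oI n.
by apply: measure_sigma_subadditive => //; exact: bigcup_measurable.
Qed.

(** The point [line_bot K] has measure [G (line_bot K)] and lies in open sets of arbitrarily small
    measure. This disposes of the initial term of a Riemann sum. *)
Lemma null_set_line_bot (S : set K) :
  Defs.null_set mu S -> S (line_bot K) -> G (line_bot K) <= 0.
Proof.
move=> S0 Sb; apply/ler_addgt0Pr => c c0; rewrite add0r.
have [I [oI SI Ic]] := null_set_cover S0 c0.
rewrite -lee_fin -muE; apply: (le_trans _ (ltW Ic)); apply: le_measure.
- by rewrite inE; exact: measurable_line_bot.
- rewrite inE; apply: bigcup_measurable => n _.
  by apply: measurable_open_line; have [] := oI n.
- move=> z /=; rewrite in_itv/= => zb; have -> : z = line_bot K by apply: le_anti; rewrite andbC.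
  exact: SI.
Qed.

(* The tags [t] with [k <= `|h t| < k.+1] are confined to an open set of
   measure less than [eps / (k.+1 * 2 ^+ k.+2)]. *)
Lemma has_gauge_integral_null (S : set K) (h : K -> R) :
  (forall x, 0 <= G x) -> Defs.null_set mu S -> (forall x, ~ S x -> h x = 0) ->
  has_gauge_integral G h 0.
Proof.
move=> Gge0 S0 hS.
have SP x : h x != 0 -> S x by move=> /eqP hx; apply: contrapT => /hS.
apply/has_gauge_integralP => eps eps0.
pose c k : R := eps / 2 * 2 ^- k.+1 / k.+1%:R.
have c0 k : 0 < c k by rewrite !divr_gt0// exprn_gt0.
have /choice[I HI] := fun k => null_set_cover S0 (c0 k).
pose lvl t := Num.truncn `|h t|.
have /choice[delta Hd] : forall t, exists U, [/\ open_interval U, U t &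
    h t != 0 -> U `<=` \bigcup_n I (lvl t) n].
  (* A tag where [h] vanishes contributes nothing and needs no restriction; any other lies in [S],
     hence in the cover chosen for its level. *)
  move=> t; have [ht|ht] := eqVneq (h t) 0.
    exists setT; split=> //; split; first exact: openT.
    by exists `]-oo, +oo[%O; rewrite set_itvE.
  have [oI sI _] := HI (lvl t); have [n _ In] := sI t (SP _ ht).
  by exists (I (lvl t) n); split=> // _ z Iz; exists n.
exists delta; first by move=> x; have [] := Hd x.
move=> s sc.
have -> : h (line_bot K) * G (line_bot K) = 0.
  have [->|hb] := eqVneq (h (line_bot K)) 0; first by rewrite mul0r.
  suff -> : G (line_bot K) = 0 by rewrite mulr0.
  by apply/eqP; rewrite eq_le Gge0 (null_set_line_bot S0 (SP _ hb)).
rewrite add0r subr0.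
pose A k := [set t | h t != 0 /\ lvl t = k].
pose M := (\max_(z <- s) lvl z.1).+1.
apply: (le_lt_trans (ler_norm_chain_sum _ Gnd sc)).
apply: (@le_lt_trans _ _ (eps / 2)); last by rewrite ltr_pdivrMr// ltr_pMr// ltr1n.
(* At a tag of level [k] the value of [|h|] is below [k.+1]; [M] exceeds the levels of the finitely
   many tags. *)
apply: (@le_trans _ _ (chain_sum G
    (fun t => \sum_(k < M) k.+1%:R * \1_(A k) t) (line_bot K) s)).
  apply: ler_chain_sum sc _ => // z zs.
  have [->|hz] := eqVneq (h z.1) 0; first by rewrite normr0; apply: sumr_ge0.
  have lM : (lvl z.1 < M)%N by rewrite ltnS; exact: leq_bigmax_seq.
  rewrite (bigD1 (Ordinal lM))//= indicE mem_set// mulr1.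
  by rewrite ler_wpDr ?sumr_ge0// ltW// truncnS_gt.
rewrite chain_sum_linear.
(* The weight [k.+1] cancels the divisor in [c k], leaving a geometric series. *)
apply: (@le_trans _ _ (\sum_(k < M) eps / 2 * 2 ^- k.+1)).
  apply: ler_sum => k _; have [oI _ muI] := HI k.
  rewrite mulrC -ler_pdivlMr// -lee_fin; apply: le_trans (ltW muI).
  apply: tag_sum_le_measure sc.
  - by apply: bigcup_open => n _; have [] := oI n.
  - by move=> t [ht <-]; have [_ _] := Hd t; exact.
by rewrite -mulr_sumr ler_piMr ?sum_half_geometric// ltW// divr_gt0.
Qed.

(** Setting all functions to 0 on the exceptional set [S] makes the convergence hold everywhere. The
    parts removed vanish off [S], so they have integral 0 whatever their values. *)
Lemma gauge_monotone_convergence_ae (f_ : nat -> K -> R) (f : K -> R)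
    (A_ : nat -> R) (A : R) :
  (forall x, 0 <= G x) -> (forall x, nondecreasing_seq (f_ ^~ x)) ->
  (forall k, has_gauge_integral G (f_ k) (A_ k)) ->
  almost_everywhere_wrt mu (fun x : K => f_ m x @[m --> \oo] --> f x) ->
  A_ k @[k --> \oo] --> A -> has_gauge_integral G f A.
Proof.
move=> Gge0 fnd fint fcvg Acvg.
pose S := [set x | ~ (f_ m x @[m --> \oo] --> f x)].
pose off (g : K -> R) x := if x \in S then 0 else g x.
pose on (g : K -> R) x := if x \in S then g x else 0.
have on0 g : has_gauge_integral G (on g) 0.
  by apply: (has_gauge_integral_null Gge0 fcvg) => x Sx; rewrite /on memNset.
have offE g : off g = g \+ on (fun x => - g x).
  by apply/funext => x; rewrite /off /on /=; case: ifP; rewrite ?subrr ?addr0.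
have offint : has_gauge_integral G (off f) A.
  apply: (@gauge_monotone_convergence _ _ _ G (fun k => off (f_ k)) _ A_) => //.
  - by move=> x m n mn; rewrite /off; case: ifP => // _; exact: fnd.
  - by move=> k; rewrite offE -[A_ k]addr0; exact: has_gauge_integralD.
  - move=> x; rewrite /off; case: ifPn => [_|]; first exact: cvg_cst.
    by rewrite notin_setE => /contrapT.
have -> : f = off f \+ on f.
  by apply/funext => x; rewrite /off /on /=; case: ifP; rewrite ?add0r ?addr0.
by rewrite -[A]addr0; exact: has_gauge_integralD.
Qed.

End NullSets.

(** * Increasing and decreasing sequences *)

Theorem theorem5p1 (R : realType) (d : Order.disp_t) (K : compactLineType d)
  (G : K -> R)
  (G_nondecreasing : forall x y : K, (x <= y)%O -> G x <= G y)
  (G_positive : forall x : K, 0 <= G x)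
  (G_amenable : amenable G)
  (mu_G : {finite_measure set (borel K) -> \bar R})
  (mu_GE : is_distribution_measure G mu_G)
  (f_ : nat -> K -> R) (f : K -> R)
  (f_monotone : (forall x : K, nondecreasing_seq (f_ ^~ x)) \/
                (forall x : K, nonincreasing_seq (f_ ^~ x)))
  (f_integrable : forall m : nat, gauge_integrable G (f_ m))
  (f_cvg : almost_everywhere_wrt mu_G (fun x : K => f_ m x @[m --> \oo] --> f x))
  (int_cvg : cvg (gauge_integral G (f_ m) @[m --> \oo])) :
  gauge_integrable G f /\
  gauge_integral G (f_ m) @[m --> \oo] --> gauge_integral G f.
Proof.
have muE := mu_GE.2.
(* Integrability makes [gauge_integral] a true integral rather than its default value 0. *)
have f_intE m : has_gauge_integral G (f_ m) (gauge_integral G (f_ m)).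
  by have [A fA] := f_integrable m; rewrite (gauge_integralE fA).
suff fint : has_gauge_integral G f (lim (gauge_integral G (f_ m) @[m --> \oo])).
  by split; [exists (lim (gauge_integral G (f_ m) @[m --> \oo]))|
             rewrite (gauge_integralE fint)].
case: f_monotone => fmon.
  exact: gauge_monotone_convergence_ae G_nondecreasing muE _ _ _ _
    G_positive fmon f_intE f_cvg int_cvg.
(* The decreasing case follows by negating the functions and their integrals. *)
have -> : f = fun x => - (- f x) by apply/funext => x; rewrite opprK.
rewrite -[lim _]opprK; apply: has_gauge_integralN.
apply: (gauge_monotone_convergence_ae G_nondecreasing muE
  (f_ := fun m x => - f_ m x) (A_ := fun m => - gauge_integral G (f_ m))) => //.
- by move=> x m n mn; rewrite lerN2; exact: fmon.
- by move=> m; exact: has_gauge_integralN.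
- move: f_cvg; rewrite /almost_everywhere_wrt.
  (* Negation leaves the exceptional set unchanged. *)
  suff -> : [set x | ~ (f_ m x @[m --> \oo] --> f x)] =
      [set x | ~ (- f_ m x @[m --> \oo] --> - f x)] by [].
  apply/seteqP; split=> x /= ncvg; apply: contra_not ncvg; last exact: cvgN.
  move=> nfx; have -> : f_ ^~ x = (fun m => - - f_ m x).
    by apply/funext => m; rewrite opprK.
  by rewrite -[f x]opprK; exact: (cvgN nfx).
- exact: cvgN.
Qed.
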